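(* Let $\phi$ be an expansive flow without singular points on a compact metric space $X$, and let $\psi$ and $N_\epsilon$ be as in the context, with $\epsilon>0$ sufficiently small. Then there is a continuous function $\mathcal L\colon N_\epsilon\to\mathbb{R}$ with the following properties: - $\mathcal L(x,y)\ge0$, with equality if and only if $x=y$; - $\ddot{\mathcal L}=\mathcal L$, where time derivatives are taken along the partial flow $\psi$.
   Context: A flow $\phi$ on a compact metric space $(X,\operatorname{dist})$ is expansive if the following holds. For every $\epsilon>0$ there is $\delta>0$ such that whenever $h\colon\mathbb{R}\to\mathbb{R}$ is continuous with $h(0)=0$ and $\operatorname{dist}(\phi_{h(t)}(x),\phi_t(y))<\delta$ for all $t\in\mathbb{R}$, then $y=\phi_s(x)$ for some $s\in(-\epsilon,\epsilon)$. Local cross sections. For a flow without singular points there are $\delta,\tau,a>0$ such that $\operatorname{dist}(x,y)\le\delta$ implies $\operatorname{dist}(x,\phi_\tau(y))-\operatorname{dist}(x,y)\ge a$. Fix such $\tau$ and set $\theta_x(y)=\int_0^\tau\operatorname{dist}(x,\phi_t(y))\,dt$. For small $\epsilon>0$ let $H_\epsilon(x)=\{y\in X:\operatorname{dist}(x,y)\le\epsilon,\ \theta_x(y)=\theta_x(x)\}$; for $\epsilon$ small these are local cross sections. Let $N_\epsilon=\{(x,y):y\in H_\epsilon(x)\}$. The partial flow $\psi$ on $N_\epsilon$ is $\psi_t(x,y)=(\phi_t(x),\phi_{h(t)}(y))$. It is defined whenever there exists a continuous $h$ on the interval between $0$ and $t$ with $h(0)=0$ and $\phi_{h(s)}(y)\in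 H_\epsilon(\phi_s(x))$ for all $s$ in that interval; such an $h$ is unique if it exists. For a function $\mathcal L$ on $N_\epsilon$, $\dot{\mathcal L}(q)=\frac{d}{dt}\big|_{t=0}\mathcal L(\psi_t(q))$ and $\ddot{\mathcal L}=(\dot{\mathcal L})^{\cdot}$. *)

(* Defs.v *)
From Stdlib Require Import Reals Lra ClassicalEpsilon.
Open Scope R_scope.

Section Defs.
Variable X : Type.
Variable dist : X -> X -> R.

Definition is_metric : Prop :=
  (forall x y, 0 <= dist x y) /\
  (forall x y, dist x y = 0 <-> x = y) /\
  (forall x y, dist x y = dist y x) /\
  (forall x y z, dist x z <= dist x y + dist y z).

Definition compact_metric : Prop :=
  forall u : nat -> X, exists x : X,
    forall e, e > 0 -> forall N : nat, exists n : nat, (n >= N)%nat /\ dist (u n) x < e.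

Variable phi : R -> X -> X.

Definition is_flow : Prop :=
  (forall x, phi 0 x = x) /\
  (forall s t x, phi (s + t) x = phi s (phi t x)) /\
  (forall t x e, e > 0 -> exists d, d > 0 /\
     forall s y, Rabs (s - t) < d -> dist y x < d -> dist (phi s y) (phi t x) < e).

Definition singular_point (x : X) : Prop := forall t, phi t x = x.

Definition no_singular_points : Prop := forall x, ~ singular_point x.

Definition expansive_flow : Prop :=
  forall eps, eps > 0 -> exists delta, delta > 0 /\
    forall (h : R -> R) (x y : X), continuity h -> h 0 = 0 ->
      (forall t, dist (phi (h t) x) (phi t y) < delta) ->
      exists s, - eps < s < eps /\ y = phi s x.

Definition cross_section_time (tau : R) : Prop :=
  tau > 0 /\ exists delta a, delta > 0 /\ a > 0 /\
    forall x y, dist x y <= delta -> dist x (phi tau y) - dist x y >= a.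

(* Riemann integral of f on [a,b] (value of RiemannInt when f is integrable;
   RiemannInt does not depend on the integrability proof) *)
Definition RInt (f : R -> R) (a b : R) : R :=
  epsilon (inhabits 0) (fun I => exists pr : Riemann_integrable f a b, RiemannInt pr = I).

Definition theta (tau : R) (x y : X) : R := RInt (fun t => dist x (phi t y)) 0 tau.

Definition H (tau eps : R) (x y : X) : Prop :=
  dist x y <= eps /\ theta tau x y = theta tau x x.

Definition Nset (tau eps : R) (q : X * X) : Prop := H tau eps (fst q) (snd q).

(* psi_t(q) is defined and equals p *)
Definition psi_rel (tau eps : R) (q : X * X) (t : R) (p : X * X) : Prop :=
  exists h : R -> R,
    (forall s, Rmin 0 t <= s <= Rmax 0 t -> forall e, e > 0 -> exists d, d > 0 /\
       forall s', Rmin 0 t <= s' <= Rmax 0 t -> Rabs (s' - s) < d ->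
         Rabs (h s' - h s) < e) /\
    h 0 = 0 /\
    (forall s, Rmin 0 t <= s <= Rmax 0 t ->
       H tau eps (phi s (fst q)) (phi (h s) (snd q))) /\
    p = (phi t (fst q), phi (h t) (snd q)).

Definition psi_derivative (tau eps : R) (F D : X * X -> R) : Prop :=
  forall q, Nset tau eps q -> forall e, e > 0 -> exists d, d > 0 /\
    forall t p, t <> 0 -> Rabs t < d -> psi_rel tau eps q t p ->
      Rabs ((F p - F q) / t - D q) < e.

Definition continuous_on_N (tau eps : R) (F : X * X -> R) : Prop :=
  forall q, Nset tau eps q -> forall e, e > 0 -> exists d, d > 0 /\
    forall q', Nset tau eps q' -> dist (fst q) (fst q') + dist (snd q) (snd q') < d ->
      Rabs (F q' - F q) < e.

End Defs.

(* Main.v *)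
(** Fix [b > eps] and a cutoff [g] equal to 0 where [dist x y <= eps] and to 1 where
    [dist x y >= b].  Let [u+ q] be the supremum of [exp (- t) * g (psi_t q)] over times
    [t >= 0] up to which the orbit of [q] stays within [dist <= b], and let [u- q] be the
    same quantity for backward time.  Since [g] vanishes on [N_eps], along [psi] one has
    [u+ (psi_t q) = e^t u+ q] and [u- (psi_t q) = e^(-t) u- q], so [L = u+ + u-] satisfies
    [L'' = L].  The exit time itself is discontinuous at internal tangencies, but [u+] and
    [u-] are not: at the exit [g = 1], and whatever happens later contributes at most that
    value.  If [L q = 0], the full orbit of [q] stays in [N_eps], and expansivity puts [q]
    on the diagonal. *)
Require Import Defs.
From Stdlib Require Import Reals Lra ClassicalEpsilon.
From Coquelicot Require Import Coquelicot.
Open Scope R_scope.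

(** * The exit potential of a partial semiflow *)

Section ExitPotential.

Variables (Q : Type) (D : Q -> Q -> R) (f : Q -> R) (Z : Q -> Prop).
Variables (F : R -> Q -> Q) (T eps b : R).

Hypothesis T_pos : 0 < T.
Hypothesis eps_lt_b : eps < b.
Hypothesis D_sym : forall p q, D p q = D q p.
Hypothesis f_lip : forall p q, Rabs (f p - f q) <= D p q.
Hypothesis F_0 : forall q, Z q -> f q <= b -> F 0 q = q.
Hypothesis F_Z : forall s q, Z q -> f q <= b -> 0 <= s <= T -> Z (F s q).
Hypothesis F_add : forall s t q, Z q -> f q <= b -> f (F s q) <= b ->
  0 <= s -> 0 <= t -> s + t <= T -> F t (F s q) = F (s + t) q.
Hypothesis F_unif : forall e, 0 < e -> exists d, 0 < d /\
  forall p q s, Z p -> Z q -> f p <= b -> f q <= b -> D p q < d -> 0 <= s <= T ->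
    D (F s p) (F s q) < e.

Definition cutoff (q : Q) : R := Rmin 1 (Rmax 0 ((f q - eps) / (b - eps))).

Lemma cutoff_bounds q : 0 <= cutoff q <= 1.
Proof.
unfold cutoff, Rmin, Rmax; repeat destruct Rle_dec; lra.
Qed.

Lemma cutoff_inside q : f q <= eps -> cutoff q = 0.
Proof.
intros Hq; unfold cutoff.
assert ((f q - eps) / (b - eps) <= 0).
{ apply Rmult_le_reg_r with (b - eps); [lra|].
  unfold Rdiv; rewrite Rmult_assoc, Rinv_l by lra; lra. }
unfold Rmin, Rmax; repeat destruct Rle_dec; lra.
Qed.

Lemma cutoff_eq0 q : cutoff q = 0 -> f q <= eps.
Proof.
intros Hq; destruct (Rle_or_lt (f q) eps) as [|Hlt]; auto; exfalso; revert Hq.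
assert (0 < (f q - eps) / (b - eps)) by (apply Rdiv_lt_0_compat; lra).
unfold cutoff, Rmin, Rmax; repeat destruct Rle_dec; lra.
Qed.

Lemma cutoff_outside q : b <= f q -> cutoff q = 1.
Proof.
intros Hq; unfold cutoff.
assert (1 <= (f q - eps) / (b - eps)).
{ apply Rmult_le_reg_r with (b - eps); [lra|].
  unfold Rdiv; rewrite Rmult_assoc, Rinv_l by lra; lra. }
unfold Rmin, Rmax; repeat destruct Rle_dec; lra.
Qed.

Lemma cutoff_unif e : 0 < e ->
  exists d, 0 < d /\ forall p q, D p q < d -> cutoff p <= cutoff q + e.
Proof.
intros He; exists (e * (b - eps)); split; [apply Rmult_lt_0_compat; lra|].
intros p q Hd.
assert (Hx : (f p - eps) / (b - eps) <= (f q - eps) / (b - eps) + e).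
{ apply Rmult_le_reg_r with (b - eps); [lra|].
  rewrite Rmult_plus_distr_r; unfold Rdiv; rewrite !Rmult_assoc, Rinv_l by lra.
  generalize (f_lip p q); unfold Rabs; destruct Rcase_abs; lra. }
unfold cutoff, Rmin, Rmax; repeat destruct Rle_dec; lra.
Qed.

(** [F] is controlled only from points of [Z] with [f <= b] and for times up to [T], so longer times
    are built from chains of steps. The endpoint is left unconstrained: the point where the orbit
    passes [b] must count, since the cutoff equals 1 there. Only starting points of steps are
    tested, so a step may jump over a short excursion beyond [b]. *)
Inductive reach : Q -> R -> Q -> Prop :=
| reach_0 q : reach q 0 q
| reach_step q s t p : Z q -> f q <= b -> 0 <= s <= T ->
    reach (F s q) t p -> reach q (s + t) p.

Lemma reach_time_ge0 q t p : reach q t p -> 0 <= t.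
Proof. induction 1; lra. Qed.

Lemma reach_one q s : Z q -> f q <= b -> 0 <= s <= T -> reach q s (F s q).
Proof.
intros; replace s with (s + 0) at 1 by ring.
apply reach_step; auto using reach_0.
Qed.

Definition exit_value (q : Q) (c : R) : Prop :=
  exists t p, reach q t p /\ c = exp (- t) * cutoff p.

Lemma exp_neg_le1 t : 0 <= t -> exp (- t) <= 1.
Proof.
intros [Ht| <-]; [|rewrite Ropp_0, exp_0; lra].
rewrite <- exp_0; left; apply exp_increasing; lra.
Qed.

Lemma exp_neg_mult t c d : c <= d -> exp (- t) * c <= exp (- t) * d.
Proof. intros; apply Rmult_le_compat_l; auto; left; apply exp_pos. Qed.

Lemma exp_neg_add s t c : exp (- (s + t)) * c = exp (- s) * (exp (- t) * c).
Proof. rewrite Ropp_plus_distr, exp_plus; ring. Qed.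

Lemma exit_value_le1 q c : exit_value q c -> c <= 1.
Proof.
intros (t & p & Hr & ->); generalize (cutoff_bounds p) (exp_neg_mult t (cutoff p) 1)
  (exp_neg_le1 t (reach_time_ge0 _ _ _ Hr)); lra.
Qed.

(** This is the quantity [u+] of the overview. The values are bounded by 1 and the trivial chain
    contributes one, so a least upper bound exists for [epsilon] to select. *)
Definition exit_potential (q : Q) : R :=
  epsilon (inhabits 0) (is_lub (exit_value q)).

Lemma exit_potential_lub q : is_lub (exit_value q) (exit_potential q).
Proof.
unfold exit_potential; apply epsilon_spec.
destruct (completeness (exit_value q)) as [m Hm].
- exists 1; intros c; apply exit_value_le1.
- exists (exp (- 0) * cutoff q), 0, q; auto using reach_0.
- now exists m.
Qed.

Lemma exit_potential_ge q t p :
  reach q t p -> exp (- t) * cutoff p <= exit_potential q.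
Proof. intros Hr; apply exit_potential_lub; now exists t, p. Qed.

Lemma exit_potential_le q m :
  (forall t p, reach q t p -> exp (- t) * cutoff p <= m) -> exit_potential q <= m.
Proof.
intros Hm; apply exit_potential_lub; intros c (t & p & Hr & ->); auto.
Qed.

Lemma cutoff_le_exit_potential q : cutoff q <= exit_potential q.
Proof.
generalize (exit_potential_ge q 0 q (reach_0 q)); rewrite Ropp_0, exp_0; lra.
Qed.

Lemma exit_potential_bounds q : 0 <= exit_potential q <= 1.
Proof.
split.
- generalize (cutoff_bounds q) (cutoff_le_exit_potential q); lra.
- apply exit_potential_le; intros t p Hr; apply (exit_value_le1 q); now exists t, p.
Qed.

(* A step that jumps over time r lands beyond F r q, unless the orbit has already left
   {f <= b}; there the cutoff is 1 and no later time can contribute more. *)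
Lemma reach_split q t p : reach q t p -> forall r, Z q -> f q <= b -> 0 <= r <= T ->
  (exists s, 0 <= s <= r /\ exp (- t) * cutoff p <= exp (- s) * cutoff (F s q)) \/
  (exists t', t = r + t' /\ reach (F r q) t' p).
Proof.
assert (Hout : forall s t' q' p', b < f q' -> 0 <= t' ->
  exp (- (s + t')) * cutoff p' <= exp (- s) * cutoff q').
{ intros s t' q' p' Hb Ht; rewrite exp_neg_add; apply exp_neg_mult.
  rewrite (cutoff_outside q') by lra.
  generalize (cutoff_bounds p') (exp_neg_mult t' (cutoff p') 1) (exp_neg_le1 t' Ht); lra. }
induction 1 as [q|q s t p HZ Hf Hs Hr IH]; intros r HZr Hfr Hrange.
- left; exists 0; split; [lra|]; rewrite F_0 by auto; lra.
- generalize (reach_time_ge0 _ _ _ Hr); intros Ht.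
  destruct (Rle_or_lt r s) as [Hrs|Hrs].
  + destruct (Rle_or_lt (f (F r q)) b) as [Hin|Hin].
    * right; exists (s - r + t); split; [ring|].
      apply reach_step; auto; [lra|].
      rewrite F_add by (auto; lra).
      now replace (r + (s - r)) with s by ring.
    * left; exists r; split; [lra|].
      replace (s + t) with (r + (s - r + t)) by ring; apply Hout; lra.
  + destruct (Rle_or_lt (f (F s q)) b) as [Hin|Hin].
    * destruct (IH (r - s)) as [(s' & Hs' & Hle)|(t' & -> & Hr')]; auto; [lra| |].
      -- left; exists (s + s'); split; [lra|].
         rewrite F_add in Hle by (auto; lra).
         rewrite !exp_neg_add; now apply exp_neg_mult.
      -- right; exists t'; split; [ring|].
         rewrite F_add in Hr' by (auto; lra).
         now replace (s + (r - s)) with r in Hr' by ring.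
    * left; exists s; split; [lra|]; apply Hout; lra.
Qed.

(** Prepending a step of length [r] to a chain from [F r q] gives a chain from [q], and every value
    is discounted by [exp (- r)]. *)
Lemma exit_potential_step q r : Z q -> f q <= b -> 0 <= r <= T ->
  exp (- r) * exit_potential (F r q) <= exit_potential q.
Proof.
intros HZ Hf Hr; apply Rmult_le_reg_l with (exp r); [apply exp_pos|].
rewrite <- Rmult_assoc, <- exp_plus, Rplus_opp_r, exp_0, Rmult_1_l.
apply exit_potential_le; intros t p Hrp.
apply Rmult_le_reg_l with (exp (- r)); [apply exp_pos|].
rewrite <- (Rmult_assoc _ (exp r)), <- exp_plus, Rplus_opp_l, exp_0, Rmult_1_l.
rewrite <- exp_neg_add; apply exit_potential_ge, reach_step; auto.
Qed.

(** Values seen during the first [n] blocks of length [T] are compared by uniform continuity, and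
    later ones weigh at most [exp (- (INR n * T))]. The error [e] does not accumulate in the
    induction: a value is settled either in the current block, at cost [e], or later, where the
    inductive error is multiplied by [exp (- T) <= 1]. *)
Lemma exit_potential_approx n : forall e, 0 < e -> exists d, 0 < d /\
  forall p q, Z p -> Z q -> D p q < d ->
    exit_potential q <= exit_potential p + exp (- (INR n * T)) + e.
Proof.
induction n as [|n IH]; intros e He.
- exists 1; split; [lra|]; intros p q _ _ _.
  simpl INR; rewrite Rmult_0_l, Ropp_0, exp_0.
  generalize (exit_potential_bounds p) (exit_potential_bounds q); lra.
- destruct (IH e He) as (d1 & Hd1 & Happ).
  destruct (cutoff_unif e He) as (d2 & Hd2 & Hcut).
  destruct (F_unif (Rmin d1 d2)) as (d3 & Hd3 & HF).
  { unfold Rmin; destruct Rle_dec; lra. }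
  exists (Rmin d2 d3); split; [unfold Rmin; destruct Rle_dec; lra|].
  intros p q HZp HZq HD.
  assert (HD2 : D p q < d2 /\ D p q < d3).
  { generalize (Rmin_l d2 d3) (Rmin_r d2 d3); lra. }
  destruct HD2 as [HD2 HD3].
  generalize (exp_pos (- (INR (S n) * T))); intros Hexp.
  (* If [p] is already outside, its potential has the maximal value 1. *)
  destruct (Rle_or_lt b (f p)) as [Hp|Hp].
  { generalize (cutoff_outside p Hp) (cutoff_le_exit_potential p)
      (exit_potential_bounds q); lra. }
  apply exit_potential_le; intros t q' Hr.
  destruct (Rle_or_lt (f q) b) as [Hq|Hq].
  (* If [q] is outside while [p] is not, then [cutoff p] is at least [1 - e], which dominates every
     value of [q] up to [e]. *)
  2:{ assert (cutoff q <= cutoff p + e) by (apply Hcut; rewrite D_sym; lra).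
      generalize (cutoff_outside q ltac:(lra)) (cutoff_le_exit_potential p)
        (exit_value_le1 q _ (ex_intro _ t (ex_intro _ q' (conj Hr eq_refl)))); lra. }
  assert (HFs : forall s, 0 <= s <= T -> D (F s p) (F s q) < d1 /\ D (F s p) (F s q) < d2).
  { intros s Hs; generalize (Rmin_l d1 d2) (Rmin_r d1 d2)
      (HF p q s HZp HZq ltac:(lra) Hq HD3 Hs); lra. }
  (* A value attained by time [T] is matched by the single step from [p] of the same length; any
     other value belongs to a chain from [F T q], to which the induction hypothesis applies. *)
  destruct (reach_split _ _ _ Hr T HZq Hq ltac:(lra)) as [(s & Hs & Hle)|(t' & -> & Hr')].
  + assert (Hc : cutoff (F s q) <= cutoff (F s p) + e).
    { apply Hcut; rewrite D_sym; now apply HFs. }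
    apply (exp_neg_mult s) in Hc; rewrite Rmult_plus_distr_l in Hc.
    generalize (exit_potential_ge _ _ _ (reach_one p s HZp ltac:(lra) Hs))
      (Rmult_le_compat_r e _ _ (Rlt_le _ _ He) (exp_neg_le1 s ltac:(lra))); lra.
  + generalize (exit_potential_ge _ _ _ Hr'); intros Hge.
    assert (Hn : exit_potential (F T q) <=
                 exit_potential (F T p) + exp (- (INR n * T)) + e).
    { apply Happ; try (apply F_Z; auto; lra); apply HFs; lra. }
    assert (Hp' := exit_potential_step p T HZp ltac:(lra) ltac:(lra)).
    rewrite exp_neg_add.
    apply Rle_trans with (exp (- T) * (exit_potential (F T p) + exp (- (INR n * T)) + e)).
    { apply exp_neg_mult; lra. }
    rewrite !Rmult_plus_distr_l, <- exp_plus.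
    replace (- T + - (INR n * T)) with (- (INR (S n) * T)) by (rewrite S_INR; ring).
    generalize (Rmult_le_compat_r e _ _ (Rlt_le _ _ He) (exp_neg_le1 T ltac:(lra))); lra.
Qed.

(** Take [n] so large that the tail [exp (- (INR n * T))] is below [e / 2], and use the one-sided
    estimate in both directions. *)
Lemma exit_potential_unif e : 0 < e -> exists d, 0 < d /\
  forall p q, Z p -> Z q -> D p q < d -> Rabs (exit_potential q - exit_potential p) < e.
Proof.
intros He.
assert (Hn : exists n, exp (- (INR n * T)) < e / 2).
{ destruct (INR_archimed T (- ln (e / 2)) T_pos) as [n Hn].
  exists n; rewrite <- (exp_ln (e / 2)) by lra; apply exp_increasing; lra. }
destruct Hn as [n Hn].
destruct (exit_potential_approx n (e / 2)) as (d & Hd & Happ); [lra|].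
exists d; split; auto; intros p q Hp Hq HD.
generalize (Happ p q Hp Hq HD); rewrite D_sym in HD; generalize (Happ q p Hq Hp HD).
intros; apply Rabs_def1; lra.
Qed.

(** One inequality is [exit_potential_step]. For the other, values dominated before time [r] vanish
    because the cutoff is 0 on [f <= eps], and all others come from chains that start at [F r q]. *)
Lemma exit_potential_flow q r : Z q -> f q <= b -> 0 <= r <= T ->
  (forall s, 0 <= s <= r -> f (F s q) <= eps) ->
  exit_potential (F r q) = exp r * exit_potential q.
Proof.
intros HZ Hf Hr Hin.
assert (Hup : exit_potential q <= exp (- r) * exit_potential (F r q)).
{ apply exit_potential_le; intros t p Hrp.
  destruct (reach_split _ _ _ Hrp r HZ Hf Hr) as [(s & Hs & Hle)|(t' & -> & Hr')].
  - rewrite (cutoff_inside (F s q)) in Hle by auto; rewrite Rmult_0_r in Hle.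
    apply Rle_trans with (1 := Hle), Rmult_le_pos; [left; apply exp_pos|].
    apply exit_potential_bounds.
  - rewrite exp_neg_add; now apply exp_neg_mult, exit_potential_ge. }
rewrite (Rle_antisym _ _ Hup (exit_potential_step q r HZ Hf Hr)).
rewrite <- Rmult_assoc, <- exp_plus, Rplus_opp_r, exp_0; ring.
Qed.

(** A vanishing potential forces the cutoff to vanish, and [exit_potential_step] carries the zero
    along the step. *)
Lemma exit_potential_eq0_step q : Z q -> exit_potential q = 0 ->
  f q <= eps /\ forall s, 0 <= s <= T -> f (F s q) <= eps /\ exit_potential (F s q) = 0.
Proof.
intros HZ Hq; assert (Hf : f q <= eps).
{ apply cutoff_eq0; generalize (cutoff_bounds q) (cutoff_le_exit_potential q); lra. }
split; auto; intros s Hs.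
assert (Hz : exit_potential (F s q) = 0).
{ generalize (exit_potential_step q s HZ ltac:(lra) Hs) (exit_potential_bounds (F s q)).
  intros Hle Hb; apply Rle_antisym; [|lra].
  apply Rmult_le_reg_l with (exp (- s)); [apply exp_pos|]; lra. }
split; auto; apply cutoff_eq0.
generalize (cutoff_bounds (F s q)) (cutoff_le_exit_potential (F s q)); lra.
Qed.

Lemma exit_potential_eq0_orbit q n : Z q -> exit_potential q = 0 ->
  let p := Nat.iter n (F T) q in
  Z p /\ f p <= eps /\ forall s, 0 <= s <= T -> f (F s p) <= eps.
Proof.
intros HZ Hq; simpl.
assert (Hn : Z (Nat.iter n (F T) q) /\ exit_potential (Nat.iter n (F T) q) = 0).
{ induction n as [|n [IHZ IH]]; [now split|]; simpl.
  destruct (exit_potential_eq0_step _ IHZ IH) as [Hf Hs].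
  split; [apply F_Z; auto; lra|apply Hs; lra]. }
destruct Hn as [HZn Hn]; destruct (exit_potential_eq0_step _ HZn Hn) as [Hf Hs].
split; [|split]; auto; intros s Hr; now apply Hs.
Qed.

(** Chains never leave an invariant set inside [f <= eps], so they only see cutoff 0. This is meant
    for the diagonal. *)
Lemma exit_potential_invariant (P : Q -> Prop) q :
  (forall p, P p -> f p <= eps) ->
  (forall s p, P p -> 0 <= s <= T -> P (F s p)) ->
  P q -> exit_potential q = 0.
Proof.
intros Hin Hinv HP; apply Rle_antisym; [|apply exit_potential_bounds].
apply exit_potential_le; intros t p Hr.
rewrite (cutoff_inside p); [lra|apply Hin].
revert HP; induction Hr; auto.
Qed.

End ExitPotential.

(** * Sections and the local flow on pairs *)

Section CompactFlow.

Variables (X : Type) (dist : X -> X -> R) (phi : R -> X -> X) (tau : R).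
Hypothesis Hmetric : is_metric X dist.
Hypothesis Hcompact : compact_metric X dist.
Hypothesis Hflow : is_flow X dist phi.

(** * Metric estimates and uniform continuity of the flow *)

Lemma dist_ge0 x y : 0 <= dist x y. Proof. apply Hmetric. Qed.
Lemma dist_refl x : dist x x = 0. Proof. now apply Hmetric. Qed.
Lemma dist_sym x y : dist x y = dist y x. Proof. apply Hmetric. Qed.
Lemma dist_triangle x y z : dist x z <= dist x y + dist y z. Proof. apply Hmetric. Qed.
Lemma phi_0 x : phi 0 x = x. Proof. apply Hflow. Qed.
Lemma phi_add s t x : phi s (phi t x) = phi (s + t) x.
Proof. symmetry; apply Hflow. Qed.

Lemma dist_lip x y x' y' : Rabs (dist x y - dist x' y') <= dist x x' + dist y y'.
Proof.
generalize (dist_triangle x x' y) (dist_triangle x' y' y) (dist_triangle x' x y')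
  (dist_triangle x y y') (dist_sym x x') (dist_sym y y').
intros; apply Rabs_le; lra.
Qed.

(** Counterexamples for [d = 1 / (n + 1)] would accumulate, by compactness of [X] and of the time
    interval, at a point [(s0, x0)] where continuity of the flow fails. *)
Lemma phi_unif K e : 0 < e -> exists d, 0 < d /\
  forall s t x y, Rabs s <= K -> Rabs (s - t) < d -> dist x y < d ->
    dist (phi s x) (phi t y) < e.
Proof.
intros He; apply NNPP; intros Hno.
set (inv n := / (INR n + 1)).
assert (Hinv : forall n, 0 < inv n).
{ intros n; apply Rinv_0_lt_compat; generalize (pos_INR n); lra. }
assert (Hinv_le : forall m n, (m <= n)%nat -> inv n <= inv m).
{ intros m n Hmn; apply Rinv_le_contravar.
  - generalize (pos_INR m); lra.
  - apply le_INR in Hmn; lra. }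
assert (Hinv_small : forall d, 0 < d -> exists n, inv n < d).
{ intros d Hd; destruct (INR_archimed d 1 Hd) as [n Hn].
  exists n; unfold inv; apply Rmult_lt_reg_l with (INR n + 1).
  - generalize (pos_INR n); lra.
  - rewrite Rinv_r; [nra|generalize (pos_INR n); lra]. }
assert (Hbad : forall n, exists w : (R * R) * (X * X),
  Rabs (fst (fst w)) <= K /\ Rabs (fst (fst w) - snd (fst w)) < inv n /\
  dist (fst (snd w)) (snd (snd w)) < inv n /\
  e <= dist (phi (fst (fst w)) (fst (snd w))) (phi (snd (fst w)) (snd (snd w)))).
{ intros n; apply NNPP; intros Hn; apply Hno; exists (inv n); split; auto.
  intros s t x y Hs Hst Hxy; apply Rnot_le_lt; intros Hge; apply Hn.
  now exists ((s, t), (x, y)). }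
set (w n := proj1_sig (constructive_indefinite_description _ (Hbad n))).
assert (Hw : forall n, Rabs (fst (fst (w n))) <= K /\
  Rabs (fst (fst (w n)) - snd (fst (w n))) < inv n /\
  dist (fst (snd (w n))) (snd (snd (w n))) < inv n /\
  e <= dist (phi (fst (fst (w n))) (fst (snd (w n))))
            (phi (snd (fst (w n))) (snd (snd (w n))))).
{ intros n; unfold w; apply proj2_sig. }
clearbody w; clear Hbad Hno.
(* The points are made to converge first; the times are then clustered along the chosen indices, so
   that both limits hold for the same terms. *)
destruct (Hcompact (fun n => fst (snd (w n)))) as [x0 Hx0].
set (Hsub k := Hx0 (inv k) (Hinv k) k).
set (sub k := proj1_sig (constructive_indefinite_description _ (Hsub k))).
assert (Hsub' : forall k, (sub k >= k)%nat /\ dist (fst (snd (w (sub k)))) x0 < inv k).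
{ intros k; unfold sub; apply proj2_sig. }
clearbody sub; clear Hsub.
destruct (Bolzano_Weierstrass (fun k => fst (fst (w (sub k)))) _ (compact_P3 (- K) K))
  as [s0 Hs0].
{ intros k; apply Rabs_le_between, Hw. }
destruct Hflow as (_ & _ & Hcont).
destruct (Hcont s0 x0 (e / 2)) as (d & Hd & Hnear); [lra|].
assert (Hd2 : 0 < d / 2) by lra.
(* From index [N] on, the distances to [x0], within the pair of points and within the pair of times
   are all below [d / 2], so both images are within [e / 2] of [phi s0 x0]. *)
destruct (Hinv_small _ Hd2) as [N HN].
destruct (Hs0 (disc s0 (mkposreal _ Hd2)) N) as (k & HkN & Hk).
{ exists (mkposreal _ Hd2); intros z Hz; exact Hz. }
unfold disc in Hk; simpl in Hk.
destruct (Hsub' k) as [Hge Hxk]; destruct (Hw (sub k)) as (_ & Hst & Hxy & Hbad).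
generalize (Hinv_le _ _ HkN) (Hinv_le _ _ Hge); intros Hi1 Hi2.
revert Hk Hxk Hst Hxy Hbad; generalize (w (sub k)); intros [[s t] [x y]]; simpl.
intros Hk Hxk Hst Hxy Hbad.
assert (H1 : dist (phi s x) (phi s0 x0) < e / 2) by (apply Hnear; lra).
assert (H2 : dist (phi t y) (phi s0 x0) < e / 2).
{ apply Hnear.
  - replace (t - s0) with (- (s - t) + (s - s0)) by ring.
    apply Rle_lt_trans with (1 := Rabs_triang _ _); rewrite Rabs_Ropp; lra.
  - generalize (dist_triangle y x x0); rewrite (dist_sym y x); lra. }
generalize (dist_triangle (phi s x) (phi s0 x0) (phi t y)).
rewrite (dist_sym (phi s0 x0)); lra.
Qed.

Lemma phi_small_time e : 0 < e -> exists d, 0 < d /\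
  forall s x, Rabs s <= d -> dist (phi s x) x <= e.
Proof.
intros He; destruct (phi_unif 0 e He) as (d & Hd & Hphi).
exists (d / 2); split; [lra|]; intros s x Hs.
rewrite <- (phi_0 x) at 2; rewrite dist_sym; left; apply Hphi.
- rewrite Rabs_R0; lra.
- replace (0 - s) with (- s) by ring; rewrite Rabs_Ropp; lra.
- rewrite dist_refl; lra.
Qed.

Lemma dist_flow_continuous x y t : continuous (fun t => dist x (phi t y)) t.
Proof.
apply continuity_pt_filterlim.
intros e He; destruct Hflow as (_ & _ & Hcont).
destruct (Hcont t y e He) as (d & Hd & Hnear).
exists d; split; auto; intros s [_ Hs].
apply Rle_lt_trans with (dist x x + dist (phi s y) (phi t y)); [apply dist_lip|].
rewrite dist_refl, Rplus_0_l; apply Hnear; [exact Hs|rewrite dist_refl; auto].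
Qed.

Lemma ex_RInt_dist_flow x y u v : ex_RInt (fun t => dist x (phi t y)) u v.
Proof. apply (ex_RInt_continuous (V := R_CompleteNormedModule)); intros; apply dist_flow_continuous. Qed.

(** * The function [theta]: uniform continuity and growth along orbits *)

Local Notation theta := (theta X dist phi tau).

(** Passes from the integral chosen by [epsilon] to the Coquelicot integral, for which linearity,
    comparison and change of variable are available. *)
Lemma theta_RInt x y : theta x y = RInt (fun t => dist x (phi t y)) 0 tau.
Proof.
unfold Defs.theta, Defs.RInt.
set (pr := ex_RInt_Reals_0 _ _ _ (ex_RInt_dist_flow x y 0 tau)).
assert (Hspec := epsilon_spec (inhabits 0)
  (fun I => exists pr : Riemann_integrable (fun t => dist x (phi t y)) 0 tau,
     RiemannInt pr = I)).
destruct Hspec as [pr' Hpr']; [now exists (RiemannInt pr), pr|].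
rewrite <- Hpr'; symmetry; apply RInt_Reals.
Qed.

Hypothesis Htau : 0 < tau.

Lemma theta_unif e : 0 < e -> exists d, 0 < d /\
  forall x y x' y', dist x x' < d -> dist y y' < d ->
    Rabs (theta x y - theta x' y') < e.
Proof.
(* The integrands will differ by at most [2 * e'], hence the integrals by at most [e / 2]. *)
intros He; set (e' := e / (4 * tau)).
assert (He' : 0 < e') by (apply Rdiv_lt_0_compat; lra).
destruct (phi_unif tau e' He') as (d & Hd & Hphi).
exists (Rmin d e'); split; [unfold Rmin; destruct Rle_dec; lra|].
intros x y x' y' Hx Hy; rewrite !theta_RInt.
generalize (Rmin_l d e') (Rmin_r d e'); intros Hl Hr.
change (Rabs (minus (RInt (fun t => dist x (phi t y)) 0 tau)
                    (RInt (fun t => dist x' (phi t y')) 0 tau)) < e).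
rewrite <- RInt_minus by apply ex_RInt_dist_flow.
apply Rle_lt_trans with ((tau - 0) * (2 * e')).
2:{ unfold e'; field_simplify; lra. }
apply abs_RInt_le_const; [lra| |].
- apply (ex_RInt_minus (V := R_NormedModule)); apply ex_RInt_dist_flow.
- intros t Ht; apply Rle_trans with (1 := dist_lip x (phi t y) x' (phi t y')).
  assert (dist (phi t y) (phi t y') < e').
  { apply Hphi; [rewrite Rabs_pos_eq; lra|rewrite Rminus_diag, Rabs_R0; auto|lra]. }
  lra.
Qed.

Lemma theta_flow x y r :
  theta x (phi r y) = RInt (fun t => dist x (phi t y)) r (r + tau).
Proof.
rewrite theta_RInt.
generalize (RInt_comp_lin (V := R_CompleteNormedModule)
  (fun t => dist x (phi t y)) 1 r 0 tau (ex_RInt_dist_flow _ _ _ _)).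
replace (1 * 0 + r) with r by ring; replace (1 * tau + r) with (r + tau) by ring.
intros <-; apply RInt_ext; intros t _; rewrite phi_add.
change (scal 1 (dist x (phi (1 * t + r) y))) with (1 * dist x (phi (1 * t + r) y)).
now rewrite !Rmult_1_l.
Qed.

Variables delta a : R.
Hypothesis Hdelta : 0 < delta.
Hypothesis Ha : 0 < a.
Hypothesis Hcross : forall x y, dist x y <= delta -> dist x (phi tau y) - dist x y >= a.

(** With [g t = dist x (phi t y)], the increment of [theta] equals the integral of
    [g (t + tau) - g t] over [[r1, r2]], and the cross-section inequality bounds that integrand
    below by [a]. *)
Lemma theta_slope x y r1 r2 : r1 <= r2 ->
  (forall r, r1 <= r <= r2 -> dist x (phi r y) <= delta) ->
  a * (r2 - r1) <= theta x (phi r2 y) - theta x (phi r1 y).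
Proof.
intros Hr Hin; rewrite !theta_flow.
set (g t := dist x (phi t y)).
assert (Hex : forall u v, ex_RInt g u v) by (intros; apply ex_RInt_dist_flow).
assert (Hch : forall u v w, RInt g u v + RInt g v w = RInt g u w).
{ intros; apply (RInt_Chasles (V := R_CompleteNormedModule)); auto. }
assert (Hshift : RInt (fun t => g (t + tau)) r1 r2 = RInt g (r1 + tau) (r2 + tau)).
{ generalize (RInt_comp_lin (V := R_CompleteNormedModule) g 1 tau r1 r2 (Hex _ _)).
  rewrite !Rmult_1_l; intros <-; apply RInt_ext; intros t _.
  change (scal 1 (g (1 * t + tau))) with (1 * g (1 * t + tau)).
  now rewrite !Rmult_1_l. }
assert (Hexs : ex_RInt (fun t => g (t + tau)) r1 r2).
{ apply (ex_RInt_continuous (V := R_CompleteNormedModule)); intros t _.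
  apply (continuous_comp (fun t => t + tau) g).
  - apply (continuous_plus (V := R_NormedModule));
      [apply continuous_id|apply continuous_const].
  - apply dist_flow_continuous. }
assert (Hle : RInt (fun t => g t + a) r1 r2 <= RInt (fun t => g (t + tau)) r1 r2).
{ apply RInt_le; auto.
  - apply (ex_RInt_plus (V := R_NormedModule)); auto; apply ex_RInt_const.
  - intros t Ht; unfold g; rewrite (Rplus_comm t), <- phi_add.
    generalize (Hcross x (phi t y) (Hin t ltac:(lra))); lra. }
assert (Hplus : RInt (fun t => g t + a) r1 r2 = RInt g r1 r2 + a * (r2 - r1)).
{ change (RInt (fun t => plus (g t) a) r1 r2 = RInt g r1 r2 + a * (r2 - r1)).
  rewrite (RInt_plus (V := R_CompleteNormedModule)); auto using ex_RInt_const.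
  rewrite (RInt_const (V := R_CompleteNormedModule)).
  change (RInt g r1 r2 + (r2 - r1) * a = RInt g r1 r2 + a * (r2 - r1)); ring. }
generalize (Hch r1 r2 (r2 + tau)) (Hch r1 (r1 + tau) (r2 + tau)); lra.
Qed.

(** The radius [rho] is a time window on which [theta] grows with slope [a]. The step [T] is so
    short that moving the base point changes the section equation by at most [2 * (a * rho / 8)],
    less than the gain [a * rho / 2] over half the window. The distances are budgeted so that a gap
    of [delta / 4] remains within [delta] after both motions. *)
Lemma local_constants : exists rho T, 0 < rho /\ 0 < T <= rho / 2 /\
  (forall r y, Rabs r <= rho -> dist (phi r y) y <= delta / 2) /\
  (forall s x, Rabs s <= T -> dist (phi s x) x <= delta / 4) /\
  (forall s x y, Rabs s <= T ->
     Rabs (theta (phi s x) y - theta x y) <= a * rho / 8 /\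
     Rabs (theta (phi s x) (phi s x) - theta x x) <= a * rho / 8).
Proof.
destruct (phi_small_time (delta / 2)) as (rho & Hrho & H1); [lra|].
destruct (phi_small_time (delta / 4)) as (T1 & HT1 & H2); [lra|].
assert (Har : 0 < a * rho / 8) by (assert (0 < a * rho) by (apply Rmult_lt_0_compat; lra); lra).
destruct (theta_unif _ Har) as (d & Hd & H3).
destruct (phi_small_time (d / 2)) as (T2 & HT2 & H4); [lra|].
exists rho, (Rmin (rho / 2) (Rmin T1 T2)).
generalize (Rmin_l (rho / 2) (Rmin T1 T2)) (Rmin_r (rho / 2) (Rmin T1 T2))
  (Rmin_l T1 T2) (Rmin_r T1 T2); intros.
split; [|split; [|split; [|split]]]; auto.
- split; auto; unfold Rmin; repeat destruct Rle_dec; lra.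
- intros s x Hs; apply H2; lra.
- intros s x y Hs.
  assert (Hsx : dist (phi s x) x < d) by (generalize (H4 s x ltac:(lra)); lra).
  split; left; apply H3; auto; rewrite dist_refl; auto.
Qed.


Variables rho T : R.
Hypothesis Hrho : 0 < rho.
Hypothesis HT : 0 < T <= rho / 2.
Hypothesis near_rho : forall r y, Rabs r <= rho -> dist (phi r y) y <= delta / 2.
Hypothesis near_T : forall s x, Rabs s <= T -> dist (phi s x) x <= delta / 4.
Hypothesis theta_near_T : forall s x y, Rabs s <= T ->
  Rabs (theta (phi s x) y - theta x y) <= a * rho / 8 /\
  Rabs (theta (phi s x) (phi s x) - theta x x) <= a * rho / 8.

(** This quantitative injectivity yields both the uniqueness of return times and their modulus of
    continuity. *)
Lemma theta_slope_abs x y r r' : dist x y <= delta / 2 -> Rabs r <= rho -> Rabs r' <= rho ->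
  a * Rabs (r - r') <= Rabs (theta x (phi r y) - theta x (phi r' y)).
Proof.
intros Hxy.
assert (Hmain : forall r r', r <= r' -> Rabs r <= rho -> Rabs r' <= rho ->
  a * Rabs (r - r') <= Rabs (theta x (phi r y) - theta x (phi r' y))).
{ clear r r'; intros r r' Hle Hr Hr'.
  rewrite (Rabs_minus_sym r), (Rabs_minus_sym (theta _ _)), (Rabs_pos_eq (r' - r)) by lra.
  apply Rle_trans with (2 := Rle_abs _); apply theta_slope; auto.
  intros u Hu; apply Rabs_le_between in Hr; apply Rabs_le_between in Hr'.
  assert (Hu' : Rabs u <= rho) by (apply Rabs_le; lra).
  generalize (dist_triangle x y (phi u y)) (near_rho u y Hu').
  rewrite (dist_sym y); lra. }
intros Hr Hr'; destruct (Rle_or_lt r r'); [now apply Hmain|].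
rewrite (Rabs_minus_sym r), (Rabs_minus_sym (theta _ _)); apply Hmain; auto; lra.
Qed.

(** * Return times and the local flow on transversal pairs *)

Definition transversal (q : X * X) : Prop :=
  theta (fst q) (snd q) = theta (fst q) (fst q).
Definition gap (q : X * X) : R := dist (fst q) (snd q).
Definition pair_dist (p q : X * X) : R := dist (fst p) (fst q) + dist (snd p) (snd q).

(** The search is confined to half of the window, so that the sum of two return times still lies in
    the window [rho] where uniqueness holds. *)
Definition return_time (q : X * X) (s : R) : R :=
  epsilon (inhabits 0) (fun r => Rabs r <= rho / 2 /\
    transversal (phi s (fst q), phi r (snd q))).

Definition local_flow (s : R) (q : X * X) : X * X :=
  (phi s (fst q), phi (return_time q s) (snd q)).

Lemma gap_moved q s : gap q <= delta / 4 -> Rabs s <= T ->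
  dist (phi s (fst q)) (snd q) <= delta / 2.
Proof.
intros Hq Hs; unfold gap in Hq.
generalize (dist_triangle (phi s (fst q)) (fst q) (snd q)) (near_T s (fst q) Hs); lra.
Qed.

(** The section function [g] has [Rabs (g 0) <= a * rho / 4] and changes by at least [a * rho / 2]
    on either side of 0, so it changes sign on [[- (rho / 2), rho / 2]]. *)
Lemma return_time_spec q s : transversal q -> gap q <= delta / 4 -> Rabs s <= T ->
  Rabs (return_time q s) <= rho / 2 /\ transversal (local_flow s q).
Proof.
destruct q as [x y]; intros HZ Hgap Hs.
unfold local_flow, return_time; apply epsilon_spec.
generalize (gap_moved _ _ Hgap Hs); unfold transversal in *; simpl in *; intros Hx'y.
set (x' := phi s x) in *.
set (g r := theta x' (phi r y) - theta x' x').
assert (Hg0 : Rabs (g 0) <= a * rho / 4).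
{ unfold g; rewrite phi_0.
  (* Transversality of [(x, y)] cancels the two terms at [x], which leaves two increments of size at
     most [a * rho / 8]. *)
  replace (theta x' y - theta x' x')
    with ((theta x' y - theta x y) - (theta x' x' - theta x x)) by lra.
  destruct (theta_near_T s x y Hs) as [H1 H2].
  apply Rle_trans with (1 := Rabs_triang _ _); rewrite Rabs_Ropp; fold x' in H1, H2; lra. }
apply Rabs_le_between in Hg0.
assert (Hin : forall r, Rabs r <= rho -> dist x' (phi r y) <= delta).
{ intros r Hr; generalize (dist_triangle x' y (phi r y)) (near_rho r y Hr).
  rewrite (dist_sym y); lra. }
destruct (IVT_cor g (- (rho / 2)) (rho / 2)) as (r & Hr & Hgr).
- intros r e He; destruct (theta_unif e He) as (d & Hd & Hth).
  destruct Hflow as (_ & _ & Hcont).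
  destruct (Hcont r y d Hd) as (d' & Hd' & Hnear).
  exists d'; split; auto; intros r' [_ Hr']; simpl; unfold Rdist, g in *.
  replace (theta x' (phi r' y) - theta x' x' - (theta x' (phi r y) - theta x' x'))
    with (theta x' (phi r' y) - theta x' (phi r y)) by ring.
  apply Hth; [rewrite dist_refl; auto|].
  apply Hnear; [exact Hr'|rewrite dist_refl; auto].
- lra.
- assert (H1 : a * (rho / 2 - 0) <= theta x' (phi (rho / 2) y) - theta x' (phi 0 y)).
  { apply theta_slope; [lra|]; intros r Hr; apply Hin, Rabs_le; lra. }
  assert (H2 : a * (0 - - (rho / 2)) <= theta x' (phi 0 y) - theta x' (phi (- (rho / 2)) y)).
  { apply theta_slope; [lra|]; intros r Hr; apply Hin, Rabs_le; lra. }
  assert (g (- (rho / 2)) <= 0) by (unfold g in *; lra).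
  assert (0 <= g (rho / 2)) by (unfold g in *; lra).
  nra.
- exists r; split; [apply Rabs_le; lra|unfold g in Hgr; lra].
Qed.

Lemma return_time_unique q s r : transversal q -> gap q <= delta / 4 -> Rabs s <= T ->
  Rabs r <= rho -> transversal (phi s (fst q), phi r (snd q)) -> return_time q s = r.
Proof.
intros HZ Hgap Hs Hr Htr; destruct (return_time_spec q s HZ Hgap Hs) as [Hb HZ'].
generalize (theta_slope_abs _ _ (return_time q s) r (gap_moved _ _ Hgap Hs) ltac:(lra) Hr).
unfold transversal, local_flow in *; simpl in *; rewrite Htr, HZ', Rminus_diag, Rabs_R0.
intros Hle; apply Rminus_diag_uniq, Rabs_eq_0.
generalize (Rabs_pos (return_time q s - r)); nra.
Qed.

Lemma return_time_0 q : transversal q -> gap q <= delta / 4 -> return_time q 0 = 0.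
Proof.
intros HZ Hgap; apply return_time_unique; auto.
1,2: rewrite Rabs_R0; lra.
rewrite !phi_0; now destruct q.
Qed.

Lemma local_flow_0 q : transversal q -> gap q <= delta / 4 -> local_flow 0 q = q.
Proof.
intros HZ Hgap; unfold local_flow; rewrite return_time_0, !phi_0 by auto; now destruct q.
Qed.

Lemma local_flow_diag x s : Rabs s <= T -> local_flow s (x, x) = (phi s x, phi s x).
Proof.
intros Hs; unfold local_flow; rewrite (return_time_unique (x, x) s s); auto.
- reflexivity.
- unfold gap; simpl; rewrite dist_refl; lra.
- lra.
- reflexivity.
Qed.

(** The two successive return times add up to a time of size at most [rho] that solves the section
    equation at [s + t]; uniqueness identifies it. *)
Lemma local_flow_add s t q : transversal q -> gap q <= delta / 4 ->
  gap (local_flow s q) <= delta / 4 -> Rabs s <= T -> Rabs t <= T -> Rabs (s + t) <= T ->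
  local_flow t (local_flow s q) = local_flow (s + t) q.
Proof.
intros HZ Hq Hs' Hs Ht Hst.
destruct (return_time_spec q s HZ Hq Hs) as [Hb HZ'].
destruct (return_time_spec _ t HZ' Hs' Ht) as [Hb' HZ''].
assert (Heq : return_time q (s + t) = return_time (local_flow s q) t + return_time q s).
{ apply return_time_unique; auto.
  - apply Rle_trans with (1 := Rabs_triang _ _); lra.
  - rewrite Rplus_comm, <- !phi_add; exact HZ''. }
unfold local_flow at 1 3; rewrite Heq; unfold local_flow at 1 3; simpl.
now rewrite !phi_add, (Rplus_comm t).
Qed.

(** The slope [a] turns a small error in the section equation into a small error in time: the return
    time of [q] nearly solves the equation for [p]. *)
Lemma return_time_unif e : 0 < e -> exists d, 0 < d /\
  forall p q s t, transversal p -> transversal q -> gap p <= delta / 4 -> gap q <= delta / 4 ->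
    Rabs s <= T -> Rabs t <= T -> pair_dist p q < d -> Rabs (s - t) < d ->
    Rabs (return_time p s - return_time q t) < e.
Proof.
intros He; assert (Hae : 0 < a * e / 2) by (assert (0 < a * e) by (apply Rmult_lt_0_compat; lra); lra).
destruct (theta_unif _ Hae) as (d1 & Hd1 & Hth).
destruct (phi_unif rho d1 Hd1) as (d & Hd & Hphi).
exists d; split; auto.
intros [x y] [x' y'] s t HZ HZ' Hg Hg' Hs Ht HD Hst.
unfold pair_dist in HD; simpl in HD.
generalize (dist_ge0 x x') (dist_ge0 y y'); intros.
destruct (return_time_spec _ _ HZ Hg Hs) as [Hb Htr].
destruct (return_time_spec _ _ HZ' Hg' Ht) as [Hb' Htr'].
revert Hb Htr Hb' Htr'; unfold transversal, local_flow; simpl.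
set (r := return_time (x, y) s); set (r' := return_time (x', y') t); intros.
generalize (theta_slope_abs _ _ r' r (gap_moved _ _ Hg Hs) ltac:(lra) ltac:(lra)).
simpl; rewrite Htr, Rabs_minus_sym.
assert (Hx : dist (phi s x) (phi t x') < d1) by (apply Hphi; lra).
assert (Hy : dist (phi r' y) (phi r' y') < d1).
{ apply Hphi; [lra|rewrite Rminus_diag, Rabs_R0; lra|lra]. }
assert (H1 := Hth _ _ _ _ Hx Hx); assert (H2 := Hth _ _ _ _ Hx Hy).
rewrite Htr' in H2; apply Rabs_def2 in H1; apply Rabs_def2 in H2.
intros Hle; apply Rmult_lt_reg_l with a; auto.
apply Rle_lt_trans with (1 := Hle), Rabs_def1; lra.
Qed.

Lemma local_flow_unif e : 0 < e -> exists d, 0 < d /\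
  forall p q s, transversal p -> transversal q -> gap p <= delta / 4 -> gap q <= delta / 4 ->
    Rabs s <= T -> pair_dist p q < d -> pair_dist (local_flow s p) (local_flow s q) < e.
Proof.
intros He; destruct (phi_unif rho (e / 2)) as (d1 & Hd1 & Hphi); [lra|].
destruct (return_time_unif d1 Hd1) as (d2 & Hd2 & Hret).
exists (Rmin d1 d2); split; [unfold Rmin; destruct Rle_dec; lra|].
intros p q s HZ HZ' Hg Hg' Hs HD.
generalize (Rmin_l d1 d2) (Rmin_r d1 d2); intros.
assert (Hr : Rabs (return_time p s - return_time q s) < d1).
{ apply Hret; auto; [lra|rewrite Rminus_diag, Rabs_R0; auto]. }
unfold pair_dist in *; simpl.
generalize (dist_ge0 (fst p) (fst q)) (dist_ge0 (snd p) (snd q)); intros.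
assert (dist (phi s (fst p)) (phi s (fst q)) < e / 2).
{ apply Hphi; [lra|rewrite Rminus_diag, Rabs_R0; lra|lra]. }
assert (dist (phi (return_time p s) (snd p)) (phi (return_time q s) (snd q)) < e / 2).
{ apply Hphi; [|lra|lra]; generalize (return_time_spec p s HZ Hg Hs); lra. }
lra.
Qed.

Lemma pair_dist_sym p q : pair_dist p q = pair_dist q p.
Proof. unfold pair_dist; now rewrite (dist_sym (fst p)), (dist_sym (snd p)). Qed.

Lemma gap_lip p q : Rabs (gap p - gap q) <= pair_dist p q.
Proof. apply dist_lip. Qed.

(** Composition with it extends a function on [[u, v]] to the whole line by constants, which serves
    the intermediate value theorem and the gluing of return times. *)
Definition clamp (u v t : R) : R := Rmax u (Rmin v t).

Lemma clamp_in u v t : u <= v -> u <= clamp u v t <= v.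
Proof. unfold clamp, Rmax, Rmin; repeat destruct Rle_dec; lra. Qed.

Lemma clamp_id u v t : u <= t <= v -> clamp u v t = t.
Proof. unfold clamp, Rmax, Rmin; repeat destruct Rle_dec; lra. Qed.

Lemma clamp_lip u v s t : u <= v -> Rabs (clamp u v s - clamp u v t) <= Rabs (s - t).
Proof.
unfold clamp, Rmax, Rmin, Rabs; repeat destruct Rle_dec; repeat destruct Rcase_abs; lra.
Qed.

(** * Agreement of the partial flow [psi] with the local flow *)

Local Notation psi_rel := (psi_rel X dist phi tau).
Local Notation Nset := (Nset X dist phi tau).

(* A lift h starting at 0 cannot leave [-rho/2, rho/2]: at a first passage between rho/2
   and rho it would coincide with the return time, which is at most rho/2. *)
Lemma psi_rel_local_flow eps q t p : eps <= delta / 4 -> Nset eps q -> Rabs t <= T ->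
  psi_rel eps q t p ->
  p = local_flow t q /\
  forall s, Rmin 0 t <= s <= Rmax 0 t -> Nset eps (local_flow s q).
Proof.
intros Heps [Hq HZ] Ht (h & Hcont & Hh0 & Hin & Hp).
set (u := Rmin 0 t) in *; set (v := Rmax 0 t) in *.
assert (Huv : u <= 0 <= v /\ u <= t <= v).
{ unfold u, v, Rmin, Rmax; repeat destruct Rle_dec; lra. }
assert (HsT : forall s, u <= s <= v -> Rabs s <= T).
{ intros s Hs; apply Rle_trans with (2 := Ht); revert Hs; unfold u, v, Rmin, Rmax, Rabs.
  repeat destruct Rle_dec; repeat destruct Rcase_abs; lra. }
assert (Huniq : forall s, u <= s <= v -> Rabs (h s) <= rho -> return_time q s = h s).
{ intros s Hs Hb; apply return_time_unique; auto.
  - unfold gap; lra.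
  - apply Hin, Hs. }
assert (Hret : forall s, u <= s <= v -> Rabs (return_time q s) <= rho / 2).
{ intros s Hs; apply return_time_spec; auto; unfold gap; lra. }
assert (Hbound : forall s, u <= s <= v -> Rabs (h s) <= rho / 2).
{ intros s Hs; apply Rnot_lt_le; intros Hbig.
  set (c := Rmin rho (Rabs (h s))).
  assert (Hc : rho / 2 < c <= rho /\ c <= Rabs (h s)).
  { unfold c, Rmin; destruct Rle_dec; lra. }
  assert (Hzs : forall z, 0 <= z <= 1 -> u <= z * s <= v).
  { intros z Hz; destruct (Rle_or_lt 0 s); split; nra. }
  (* The path from [z = 0] to [z = 1] leads from time 0 to time [s] for either sign of [s]. *)
  destruct (IVT_cor (fun z => Rabs (h (clamp u v (z * s))) - c) 0 1) as (z & Hz & Hhz).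
  - intros z e He.
    destruct (Hcont (clamp u v (z * s)) (clamp_in u v (z * s) ltac:(lra)) e He) as (d & Hd & Hnear).
    exists (d / (Rabs s + 1)); generalize (Rabs_pos s); intros Hs0; split.
    { apply Rdiv_lt_0_compat; lra. }
    intros z' [_ Hz']; simpl in *; unfold Rdist in *.
    replace (Rabs (h (clamp u v (z' * s))) - c - (Rabs (h (clamp u v (z * s))) - c))
      with (Rabs (h (clamp u v (z' * s))) - Rabs (h (clamp u v (z * s)))) by ring.
    apply Rle_lt_trans with (1 := Rabs_triang_inv2 _ _).
    apply Hnear; [apply clamp_in; lra|].
    apply Rle_lt_trans with (1 := clamp_lip u v (z' * s) (z * s) ltac:(lra)).
    rewrite <- Rmult_minus_distr_r, Rabs_mult.
    apply Rle_lt_trans with (Rabs (z' - z) * (Rabs s + 1)).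
    { generalize (Rabs_pos (z' - z)); nra. }
    apply Rmult_lt_compat_r with (r := Rabs s + 1) in Hz'; [|lra].
    unfold Rdiv in Hz'; rewrite Rmult_assoc, Rinv_l in Hz'; lra.
  - lra.
  - rewrite Rmult_0_l, Rmult_1_l, !clamp_id, Hh0, Rabs_R0 by lra; nra.
  - rewrite clamp_id in Hhz by auto.
    specialize (Huniq (z * s) (Hzs z Hz) ltac:(lra)).
    generalize (Hret (z * s) (Hzs z Hz)); rewrite Huniq; lra. }
assert (Heq : forall s, u <= s <= v -> local_flow s q = (phi s (fst q), phi (h s) (snd q))).
{ intros s Hs; unfold local_flow; rewrite Huniq; auto; generalize (Hbound s Hs); lra. }
split.
- rewrite Hp, Heq; auto; lra.
- intros s Hs; rewrite Heq by auto; apply Hin, Hs.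
Qed.

(** * Forward and backward escape along the partial flow *)

Variable eps : R.
Hypothesis Heps : 0 < eps < delta / 4.

(* sigma = 1 is forward time and sigma = -1 backward time. *)
Definition directed_flow (sigma s : R) (q : X * X) : X * X := local_flow (sigma * s) q.

(** The outer radius is [delta / 4], the gap up to which return times are known to exist. *)
Definition escape (sigma : R) (q : X * X) : R :=
  exit_potential (X * X) gap transversal (directed_flow sigma) T eps (delta / 4) q.

Section Direction.

Variable sigma : R.
Hypothesis Hsigma : Rabs sigma = 1.

Lemma directed_time s : 0 <= s <= T -> Rabs (sigma * s) <= T.
Proof. intros Hs; rewrite Rabs_mult, Hsigma, Rmult_1_l, Rabs_pos_eq; lra. Qed.

Lemma sigma_sqr : sigma * sigma = 1.
Proof. revert Hsigma; unfold Rabs; destruct Rcase_abs; intros; nra. Qed.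

Lemma directed_flow_0 q : transversal q -> gap q <= delta / 4 -> directed_flow sigma 0 q = q.
Proof. intros; unfold directed_flow; rewrite Rmult_0_r; now apply local_flow_0. Qed.

Lemma directed_flow_transversal s q : transversal q -> gap q <= delta / 4 -> 0 <= s <= T ->
  transversal (directed_flow sigma s q).
Proof. intros; apply return_time_spec; auto using directed_time. Qed.

Lemma directed_flow_add s t q : transversal q -> gap q <= delta / 4 ->
  gap (directed_flow sigma s q) <= delta / 4 -> 0 <= s -> 0 <= t -> s + t <= T ->
  directed_flow sigma t (directed_flow sigma s q) = directed_flow sigma (s + t) q.
Proof.
intros; unfold directed_flow.
rewrite local_flow_add, Rmult_plus_distr_l; auto.
1,2: apply directed_time; lra.
rewrite <- Rmult_plus_distr_l; apply directed_time; lra.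
Qed.

Lemma directed_flow_unif e : 0 < e -> exists d, 0 < d /\
  forall p q s, transversal p -> transversal q -> gap p <= delta / 4 -> gap q <= delta / 4 ->
    pair_dist p q < d -> 0 <= s <= T ->
    pair_dist (directed_flow sigma s p) (directed_flow sigma s q) < e.
Proof.
intros He; destruct (local_flow_unif e He) as (d & Hd & Hunif).
exists d; split; auto; intros; apply Hunif; auto using directed_time.
Qed.

Lemma escape_ge0 q : 0 <= escape sigma q.
Proof. apply exit_potential_bounds; lra. Qed.

Lemma escape_unif e : 0 < e -> exists d, 0 < d /\
  forall p q, transversal p -> transversal q -> pair_dist p q < d ->
    Rabs (escape sigma q - escape sigma p) < e.
Proof.
intros He; apply exit_potential_unif with (D := pair_dist); auto; try lra.
- apply pair_dist_sym.
- apply gap_lip.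
- apply directed_flow_0.
- intros; now apply directed_flow_transversal.
- apply directed_flow_add.
- apply directed_flow_unif.
Qed.

Lemma escape_directed_flow q r : transversal q -> gap q <= eps -> 0 <= r <= T ->
  (forall s, 0 <= s <= r -> gap (directed_flow sigma s q) <= eps) ->
  escape sigma (directed_flow sigma r q) = exp r * escape sigma q.
Proof.
intros; apply exit_potential_flow; auto; try lra.
- apply directed_flow_0.
- intros; now apply directed_flow_transversal.
- apply directed_flow_add.
Qed.

(** The whole [psi] segment is a local flow segment inside [Nset eps]. If [sigma * t >= 0] the
    scaling law applies at [q]; otherwise it applies at the endpoint, whose directed orbit leads
    back to [q]. *)
Lemma escape_psi q t p : Nset eps q -> Rabs t <= T -> psi_rel eps q t p ->
  escape sigma p = exp (sigma * t) * escape sigma q.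
Proof.
intros Hq Ht Hpsi; assert (Hq' := Hq); destruct Hq' as [Hgq HZq].
destruct (psi_rel_local_flow eps q t p ltac:(lra) Hq Ht Hpsi) as [-> Hin].
assert (Hsq := sigma_sqr).
assert (Hst : sigma * (sigma * t) = t) by (rewrite <- Rmult_assoc, Hsq; ring).
assert (Hstb : Rabs (sigma * t) <= T) by (rewrite Rabs_mult, Hsigma; lra).
apply Rabs_le_between in Hstb.
assert (Hseg : forall w, 0 <= w <= 1 -> Rmin 0 t <= w * t <= Rmax 0 t).
{ intros w Hw; unfold Rmin, Rmax; destruct Rle_dec; split; nra. }
assert (Hbetween : forall s, 0 <= s <= Rabs t -> exists w, 0 <= w <= 1 /\ s = w * Rabs t).
{ intros s Hs; destruct (Req_dec (Rabs t) 0) as [H0|H0].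
  - exists 0; split; [lra|]; rewrite H0 in *; lra.
  - exists (s / Rabs t); split; [|field; auto].
    split; [apply Rdiv_le_0_compat; lra|].
    apply Rmult_le_reg_r with (Rabs t); [lra|].
    unfold Rdiv; rewrite Rmult_assoc, Rinv_l; lra. }
destruct (Rle_or_lt 0 (sigma * t)) as [Hpos|Hneg].
- assert (Habs : Rabs t = sigma * t).
  { rewrite <- (Rabs_pos_eq (sigma * t)), Rabs_mult, Hsigma; lra. }
  rewrite <- escape_directed_flow; auto; [unfold directed_flow; now rewrite Hst|lra|].
  intros s Hs; rewrite <- Habs in Hs; destruct (Hbetween s Hs) as (w & Hw & ->).
  apply (Hin (sigma * (w * Rabs t))).
  replace (sigma * (w * Rabs t)) with (w * t) by (rewrite Habs, <- Hst at 1; ring); auto.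
- assert (Habs : Rabs t = - (sigma * t)).
  { rewrite <- (Rabs_left (sigma * t)), Rabs_mult, Hsigma by auto; lra. }
  assert (Hend : Nset eps (local_flow t q)).
  { apply Hin; unfold Rmin, Rmax; destruct Rle_dec; lra. }
  destruct Hend as [Hgp HZp].
  (* The directed orbit of the endpoint retraces the segment. *)
  assert (Hback : forall w, 0 <= w <= 1 ->
    directed_flow sigma (w * Rabs t) (local_flow t q) = local_flow ((1 - w) * t) q).
  { intros w Hw; unfold directed_flow.
    replace (sigma * (w * Rabs t)) with (- w * t) by (rewrite Habs, <- Hst at 1; ring).
    rewrite local_flow_add; auto; try (unfold gap in *; lra).
    - f_equal; ring.
    - rewrite Rabs_mult, Rabs_Ropp, (Rabs_pos_eq w) by lra; generalize (Rabs_pos t); nra.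
    - replace (t + - w * t) with ((1 - w) * t) by ring.
      rewrite Rabs_mult, (Rabs_pos_eq (1 - w)) by lra; generalize (Rabs_pos t); nra. }
  assert (Hback1 : directed_flow sigma (Rabs t) (local_flow t q) = q).
  { rewrite <- (Rmult_1_l (Rabs t)), Hback, Rminus_diag, Rmult_0_l by lra.
    apply local_flow_0; auto; unfold gap in *; lra. }
  assert (Hesc := escape_directed_flow (local_flow t q) (Rabs t) HZp Hgp
    (conj (Rabs_pos t) Ht)).
  rewrite Hback1 in Hesc.
  rewrite Hesc; [|intros s Hs; destruct (Hbetween s Hs) as (w & Hw & ->)].
  + rewrite <- Rmult_assoc, <- exp_plus, Habs, Rplus_opp_r, exp_0; ring.
  + rewrite Hback by auto; apply (Hin ((1 - w) * t)), Hseg; lra.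
Qed.

Lemma escape_diag x : escape sigma (x, x) = 0.
Proof.
apply exit_potential_invariant with (P := fun q => fst q = snd q); auto; try lra.
- intros [y z] Hyz; simpl in Hyz; subst z; unfold gap; simpl; rewrite dist_refl; lra.
- intros s [y z] Hyz Hs; simpl in Hyz; subst z.
  unfold directed_flow; rewrite local_flow_diag by now apply directed_time.
  reflexivity.
Qed.

(** * Gluing return times into a reparametrization for an orbit that never escapes *)

Section Orbit.

Variable q : X * X.
Let orbit n := Nat.iter n (directed_flow sigma T) q.
Hypothesis Horbit : forall n, transversal (orbit n) /\ gap (orbit n) <= eps /\
  forall s, 0 <= s <= T -> gap (directed_flow sigma s (orbit n)) <= eps.

(** Summand [k] measures the part of step [k] completed by time [t]: it is 0 before the step, by
    [return_time_0], and the full return time after it. Continuity in [t] thus needs no matching at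
    the times [INR k * T]. *)
Fixpoint lift_upto (n : nat) (t : R) : R :=
  match n with
  | O => 0
  | S k => return_time (orbit k) (sigma * clamp 0 T (t - INR k * T)) + lift_upto k t
  end.

Lemma clamp_below n t : t <= INR n * T -> clamp 0 T (t - INR n * T) = 0.
Proof. unfold clamp, Rmax, Rmin; repeat destruct Rle_dec; lra. Qed.

Lemma clamp_above n t : INR (S n) * T <= t -> clamp 0 T (t - INR n * T) = T.
Proof. rewrite S_INR; unfold clamp, Rmax, Rmin; repeat destruct Rle_dec; lra. Qed.

Lemma lift_upto_extend n t : t <= INR n * T -> forall m, (n <= m)%nat ->
  lift_upto m t = lift_upto n t.
Proof.
intros Ht m Hnm; induction Hnm as [|m Hnm IH]; auto.
destruct (Horbit m) as (HZ & Hg & _).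
simpl; rewrite IH, clamp_below, Rmult_0_r, return_time_0; auto; [ring|lra|].
apply Rle_trans with (1 := Ht), Rmult_le_compat_r; [lra|now apply le_INR].
Qed.

Lemma lift_upto_eq m n t : t <= INR n * T -> t <= INR m * T -> lift_upto m t = lift_upto n t.
Proof.
intros Hn Hm; destruct (Nat.le_ge_cases n m).
- now apply lift_upto_extend.
- symmetry; now apply lift_upto_extend.
Qed.

(** From time [INR n * T] on, all clamps in the sum are saturated, so it adds up the return times of
    [n] complete steps. *)
Lemma lift_upto_position n t : INR n * T <= t ->
  (phi (sigma * (INR n * T)) (fst q), phi (lift_upto n t) (snd q)) = orbit n.
Proof.
induction n as [|n IH]; intros Ht.
- simpl; rewrite Rmult_0_l, Rmult_0_r, !phi_0; now destruct q.
- assert (Hn : INR n * T <= t) by (rewrite S_INR in Ht; lra).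
  change (orbit (S n)) with (directed_flow sigma T (orbit n)).
  unfold directed_flow, local_flow; simpl lift_upto.
  rewrite clamp_above by auto; rewrite <- !phi_add.
  rewrite <- (IH Hn) at 2 4; simpl fst; simpl snd; rewrite phi_add.
  replace (sigma * (INR (S n) * T)) with (sigma * T + sigma * (INR n * T))
    by (rewrite S_INR; ring).
  now rewrite phi_add.
Qed.

Lemma lift_upto_gap n t : INR n * T <= t <= INR (S n) * T ->
  dist (phi (sigma * t) (fst q)) (phi (lift_upto (S n) t) (snd q)) <= eps.
Proof.
intros Ht; rewrite S_INR in Ht; destruct (Horbit n) as (_ & _ & Hs).
specialize (Hs (t - INR n * T) ltac:(lra)).
unfold gap, directed_flow, local_flow in Hs; simpl in Hs |- *.
rewrite clamp_id by lra; rewrite <- phi_add.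
rewrite <- (lift_upto_position n t ltac:(lra)) in Hs at 1 3; simpl in Hs.
rewrite phi_add in Hs.
now replace (sigma * (t - INR n * T) + sigma * (INR n * T)) with (sigma * t) in Hs by ring.
Qed.

Lemma lift_upto_continuity n : continuity (lift_upto n).
Proof.
induction n as [|n IH]; [apply continuity_const; now intros ? ?|].
apply (continuity_plus (fun t => return_time (orbit n) (sigma * clamp 0 T (t - INR n * T))));
  auto.
intros t e He; destruct (return_time_unif e He) as (d & Hd & Hunif).
exists d; split; auto; intros t' [_ Ht']; simpl in *; unfold Rdist in *.
destruct (Horbit n) as (HZ & Hg & _).
apply Hunif; auto; try lra; try (apply directed_time, clamp_in; lra).
- unfold pair_dist; rewrite !dist_refl; lra.
- rewrite <- Rmult_minus_distr_l, Rabs_mult, Hsigma, Rmult_1_l.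
  apply Rle_lt_trans with (2 := Ht'), Rle_trans with (1 := clamp_lip 0 T _ _ ltac:(lra)).
  right; f_equal; ring.
Qed.

(** The finite sums agree wherever they cover [t], so any choice of a long enough sum gives one
    function. Its vanishing for [t <= 0] allows the forward and backward lifts to be added. *)
Lemma lift_exists : exists h, continuity h /\ (forall t, t <= 0 -> h t = 0) /\
  forall t, 0 <= t -> dist (phi (sigma * t) (fst q)) (phi (h t) (snd q)) <= eps.
Proof.
assert (Hn : forall t, exists n, t < INR n * T).
{ intros t; destruct (INR_archimed T t ltac:(lra)) as [n Hn]; now exists n. }
set (num t := proj1_sig (constructive_indefinite_description _ (Hn t))).
assert (Hnum : forall t, t < INR (num t) * T) by (intros; unfold num; apply proj2_sig).
clearbody num.
assert (Heq : forall n t, t <= INR n * T -> lift_upto (num t) t = lift_upto n t).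
{ intros n t Ht; apply lift_upto_eq; auto; left; auto. }
exists (fun t => lift_upto (num t) t); split; [|split].
- intros t e He.
  destruct (lift_upto_continuity (num t) t e He) as (d & Hd & Hnear).
  generalize (Hnum t); intros Ht.
  (* The second bound keeps [t'] below [INR (num t) * T], where the sum with [num t] terms still
     represents the lift. *)
  exists (Rmin d (INR (num t) * T - t)); split; [unfold Rmin; destruct Rle_dec; lra|].
  intros t' [HD Ht']; simpl in *; unfold Rdist in *.
  generalize (Rmin_l d (INR (num t) * T - t)) (Rmin_r d (INR (num t) * T - t)); intros.
  rewrite (Heq (num t) t').
  + apply Hnear; split; auto; lra.
  + assert (Hlt : Rabs (t' - t) < INR (num t) * T - t) by lra.
    apply Rabs_def2 in Hlt; lra.
- intros t Ht; now rewrite (Heq O) by (simpl; lra).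
- intros t Ht.
  assert (Hfloor : exists n, INR n * T <= t <= INR (S n) * T).
  { generalize (Hnum t); induction (num t) as [|n IH]; simpl INR; [lra|].
    intros HSn; destruct (Rle_or_lt (INR n * T) t); [exists n; split; auto; simpl INR; lra|auto]. }
  destruct Hfloor as [n Hfl]; rewrite (Heq (S n)) by lra; now apply lift_upto_gap.
Qed.

End Orbit.

Lemma escape_eq0_lift q : transversal q -> escape sigma q = 0 ->
  exists h, continuity h /\ (forall t, t <= 0 -> h t = 0) /\
    forall t, 0 <= t -> dist (phi (sigma * t) (fst q)) (phi (h t) (snd q)) <= eps.
Proof.
intros HZ Hq; apply lift_exists; intros n.
apply exit_potential_eq0_orbit with (b := delta / 4); auto; try lra.
intros; now apply directed_flow_transversal.
Qed.

End Direction.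

(** * The Lyapunov function and its properties *)

Definition lyapunov (c : R) (q : X * X) : R := escape 1 q + c * escape (-1) q.

Lemma Rabs_minus1 : Rabs (-1) = 1.
Proof. rewrite Rabs_left; lra. Qed.

Lemma lyapunov_continuous : continuous_on_N X dist phi tau eps (lyapunov 1).
Proof.
intros p [_ HZp] e He.
destruct (escape_unif 1 Rabs_R1 (e / 2)) as (d1 & Hd1 & H1); [lra|].
destruct (escape_unif (-1) Rabs_minus1 (e / 2)) as (d2 & Hd2 & H2); [lra|].
exists (Rmin d1 d2); split; [unfold Rmin; destruct Rle_dec; lra|].
intros q [_ HZq] HD; generalize (Rmin_l d1 d2) (Rmin_r d1 d2); intros.
specialize (H1 p q HZp HZq ltac:(unfold pair_dist; lra)).
specialize (H2 p q HZp HZq ltac:(unfold pair_dist; lra)).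
apply Rabs_def2 in H1; apply Rabs_def2 in H2; unfold lyapunov; apply Rabs_def1; lra.
Qed.

Lemma exp_combination_derivative c1 c2 e : 0 < e -> exists d, 0 < d /\
  forall t, t <> 0 -> Rabs t < d ->
    Rabs ((exp t * c1 + exp (- t) * c2 - (c1 + c2)) / t - (c1 - c2)) < e.
Proof.
intros He.
assert (Hder : derivable_pt_lim (fun t => exp t * c1 + exp (- t) * c2) 0 (c1 - c2)).
{ apply is_derive_Reals; auto_derive; auto; rewrite Ropp_0, exp_0; ring. }
destruct (Hder e He) as [d Hd].
exists d; split; [apply d|]; intros t Ht Htd; specialize (Hd t Ht Htd).
rewrite Rplus_0_l, Ropp_0, exp_0, !Rmult_1_l in Hd; exact Hd.
Qed.

(** Along [psi] the two escapes scale by [exp t] and [exp (- t)], so differentiation flips the sign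
    of the coefficient [c]. The cases [c = 1] and [c = -1] give both derivatives at once. *)
Lemma lyapunov_psi_derivative (c : R) :
  psi_derivative X dist phi tau eps (lyapunov c) (lyapunov (- c)).
Proof.
intros q Hq e He.
destruct (exp_combination_derivative (escape 1 q) (c * escape (-1) q) e He)
  as (d & Hd & Hder).
exists (Rmin d T); split; [unfold Rmin; destruct Rle_dec; lra|].
intros t p Ht Htd Hpsi; generalize (Rmin_l d T) (Rmin_r d T); intros.
unfold lyapunov; rewrite (escape_psi 1 Rabs_R1 q t p), (escape_psi (-1) Rabs_minus1 q t p)
  by (auto; lra).
specialize (Hder t Ht ltac:(lra)).
replace (1 * t) with t by ring; replace (-1 * t) with (- t) by ring.
replace (c * (exp (- t) * escape (-1) q)) with (exp (- t) * (c * escape (-1) q)) by ring.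
now rewrite Ropp_mult_distr_l_reverse.
Qed.

Variable exp_delta : R.
Hypothesis Hexpansive : forall (h : R -> R) (x y : X), continuity h -> h 0 = 0 ->
  (forall t, dist (phi (h t) x) (phi t y) < exp_delta) ->
  exists s, - rho < s < rho /\ y = phi s x.
Hypothesis Heps_exp : eps < exp_delta.

(** Both escapes vanish, so the two half-orbits lift to one reparametrization of the orbit of [y]
    shadowing that of [x]. Expansivity at precision [rho] gives [x = phi s y] with [s] inside the
    uniqueness window of return times. *)
Lemma lyapunov_eq0 q : Nset eps q -> lyapunov 1 q = 0 -> fst q = snd q.
Proof.
destruct q as [x y]; intros [Hg HZ] HL.
generalize (escape_ge0 1 (x, y)) (escape_ge0 (-1) (x, y)); unfold lyapunov in HL; intros.
destruct (escape_eq0_lift 1 Rabs_R1 (x, y) HZ ltac:(lra)) as (h1 & Hc1 & Hz1 & Hd1).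
destruct (escape_eq0_lift (-1) Rabs_minus1 (x, y) HZ ltac:(lra)) as (h2 & Hc2 & Hz2 & Hd2).
destruct (Hexpansive (fun t => h1 t + h2 (- t)) y x) as (s & Hs & Hxy).
- apply (continuity_plus h1 (fun t => h2 (- t))); auto.
  apply (continuity_comp Ropp h2); auto.
  apply continuity_opp, derivable_continuous, derivable_id.
- rewrite Ropp_0, Hz1, Hz2; lra.
- intros t; rewrite dist_sym; apply Rle_lt_trans with (2 := Heps_exp).
  destruct (Rle_or_lt 0 t) as [Ht|Ht].
  + rewrite (Hz2 (- t)), Rplus_0_r by lra; generalize (Hd1 t Ht); now rewrite Rmult_1_l.
  + rewrite (Hz1 t), Rplus_0_l by lra; generalize (Hd2 (- t) ltac:(lra)).
    now replace (-1 * - t) with t by ring.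
- simpl in *; assert (Hy : y = phi (- s) x).
  { rewrite Hxy, phi_add, Rplus_opp_l, phi_0; reflexivity. }
  assert (HT0 : Rabs 0 <= T) by (rewrite Rabs_R0; lra).
  assert (Hgap : gap (x, x) <= delta / 4) by (unfold gap; simpl; rewrite dist_refl; lra).
  (* Both [x] and [y = phi (- s) x] lie on the section through [x], so uniqueness of the return time
     forces [s = 0]. *)
  assert (Hs0 : return_time (x, x) 0 = - s).
  { apply return_time_unique; auto; [reflexivity|apply Rabs_le; lra|].
    simpl; rewrite phi_0, <- Hy; exact HZ. }
  rewrite return_time_0 in Hs0 by (auto; reflexivity).
  rewrite Hy, <- Hs0, phi_0; reflexivity.
Qed.

Lemma lyapunov_function : exists L : X * X -> R,
  continuous_on_N X dist phi tau eps L /\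
  (forall q, Nset eps q -> L q >= 0 /\ (L q = 0 <-> fst q = snd q)) /\
  exists Ld Ldd : X * X -> R,
    psi_derivative X dist phi tau eps L Ld /\
    psi_derivative X dist phi tau eps Ld Ldd /\
    (forall q, Nset eps q -> Ldd q = L q).
Proof.
exists (lyapunov 1); split; [apply lyapunov_continuous|split].
- intros q Hq; split; [|split].
  + generalize (escape_ge0 1 q) (escape_ge0 (-1) q); unfold lyapunov; lra.
  + now apply lyapunov_eq0.
  + destruct q as [x y]; simpl; intros <-; unfold lyapunov.
    rewrite (escape_diag 1 Rabs_R1), (escape_diag (-1) Rabs_minus1); ring.
- exists (lyapunov (- (1))), (lyapunov (- - (1))).
  split; [|split]; try apply lyapunov_psi_derivative.
  intros q _; now rewrite Ropp_involutive.
Qed.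

End CompactFlow.

Theorem mainTheorem13 (X : Type) (dist : X -> X -> R) (phi : R -> X -> X) (tau : R) :
  is_metric X dist -> compact_metric X dist ->
  is_flow X dist phi -> expansive_flow X dist phi -> no_singular_points X phi ->
  cross_section_time X dist phi tau ->
  exists eps0, eps0 > 0 /\ forall eps, 0 < eps < eps0 ->
    exists L : X * X -> R,
      continuous_on_N X dist phi tau eps L /\
      (forall q, Nset X dist phi tau eps q -> L q >= 0 /\ (L q = 0 <-> fst q = snd q)) /\
      exists Ld Ldd : X * X -> R,
        psi_derivative X dist phi tau eps L Ld /\
        psi_derivative X dist phi tau eps Ld Ldd /\
        (forall q, Nset X dist phi tau eps q -> Ldd q = L q).
Proof.
intros Hm Hc Hf Hexp _ (Htau & delta & a & Hdelta & Ha & Hcross).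
destruct (local_constants X dist phi tau Hm Hc Hf Htau delta a Hdelta Ha)
  as (rho & T & Hrho & HT & H1 & H2 & H3).
destruct (Hexp rho Hrho) as (d & Hd & Hexpd).
(* The bound [delta / 4] leaves room for the cutoff between [eps] and the outer radius; the bound
   [d] makes pairs that never escape subject to expansivity. *)
exists (Rmin (delta / 4) d); split; [unfold Rmin; destruct Rle_dec; lra|].
intros eps Heps; generalize (Rmin_l (delta / 4) d) (Rmin_r (delta / 4) d); intros.
apply lyapunov_function with delta a rho T d; auto; lra.
Qed.
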